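(* Let $G$ and $H$ be circularly ordered groups, with left-invariant circular orders $c_G$ and $c_H$. Then there exists a unique left-invariant circular order $c$ on the free product $G*H$ that satisfies the initial conditions $$c|_{G^3}=c_G,\qquad c|_{H^3}=c_H,\qquad c(e,g,h)=+1,$$ $$c(g_1,g_2,h)=c_G(g_1,g_2,e),\qquad c(g,h_1,h_2)=c_H(e,h_1,h_2)$$ for all $g,g_1,g_2\in G\setminus\{e\}$ and $h,h_1,h_2\in H\setminus\{e\}$, together with the lexicographical condition $$c(xw_1,w_2,w_3)=c(x,w_2,w_3)$$ for all reduced words $xw_1$, $w_2$ and $w_3$ in $G*H$ (where $x$ is the leftmost letter of $xw_1$) such that $x$ is not the leftmost letter of $w_2$ or $w_3$.
   Context: A left-invariant circular order on a group $G$ is a map $\phi:G^3\to\{-1,0,1\}$ such that: (DV) $\phi(x,y,z)=0$ if and only if at least two of $x,y,z$ are equal; (C) $\phi(g_1,g_2,g_3)-\phi(g_0,g_2,g_3)+\phi(g_0,g_1,g_3)-\phi(g_0,g_1,g_2)=0$ for all $g_0,g_1,g_2,g_3\in G$; (H) $\phi(gg_0,gg_1,gg_2)=\phi(g_0,g_1,g_2)$ for all $g,g_0,g_1,g_2\in G$. Reduced words in $G*H$ are the (possibly empty) words whose letters are nonidentity elements alternately from $G$ and $H$; each element of $G*H$ is identified with its unique reduced word, and $e$ denotes the identity (empty word). *)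

(* Defs.v *)
From HB Require Import structures.
From mathcomp Require Import all_boot all_order all_algebra.

Set Implicit Arguments.
Unset Strict Implicit.
Unset Printing Implicit Defensive.

Local Open Scope group_scope.

Section CircularOrder.
Variable G : groupType.

Definition left_invariant_circular_order (c : G -> G -> G -> int) : Prop :=
  [/\ forall x y z, c x y z \in [:: -1; 0; 1]%R,
      forall x y z, c x y z = 0%R <-> [\/ x = y, y = z | x = z],
      forall x0 x1 x2 x3,
        (c x1 x2 x3 - c x0 x2 x3 + c x0 x1 x3 - c x0 x1 x2 = 0)%R
    & forall g x0 x1 x2, c (g * x0) (g * x1) (g * x2) = c x0 x1 x2].

End CircularOrder.

Section FreeProduct.
Variables G H : groupType.

Definition letter : Type := (G + H)%type.

Definition is_inl (l : letter) : bool := if l is inl _ then true else false.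

Definition nontrivial_letter (l : letter) : bool :=
  match l with inl g => g != 1 | inr h => h != 1 end.

Definition reduced (w : seq letter) : bool :=
  all nontrivial_letter w && sorted (fun a b => is_inl a != is_inl b) w.

Record free_product := FreeProduct {
  word :> seq letter;
  _ : reduced word }.

HB.instance Definition _ := [isSub for word].
HB.instance Definition _ := [Choice of free_product by <:].

(* The reduced form of l :: w, when w is reduced; l may be an identity
   element, in which case the result is w. *)
Definition letter_mul (l : letter) (w : seq letter) : seq letter :=
  match l, w with
  | inl g, inl g' :: w' => if g * g' == 1 then w' else inl (g * g') :: w'
  | inr h, inr h' :: w' => if h * h' == 1 then w' else inr (h * h') :: w'
  | _, _ => if nontrivial_letter l then l :: w else w
  end.

Arguments letter_mul !l !w /.

Definition letter_inv (l : letter) : letter :=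
  match l with inl g => inl g^-1 | inr h => inr h^-1 end.

Lemma reduced_cons l w : reduced (l :: w) =
  [&& nontrivial_letter l, (if w is a :: _ then is_inl l != is_inl a else true)
    & reduced w].
Proof.
rewrite /reduced; case: w => [|a w] /=; first by rewrite !andbT.
rewrite -!andbA; congr andb; rewrite [RHS]andbCA; congr andb.
by rewrite [RHS]andbCA.
Qed.

Lemma reduced_letter_mul l w : reduced w -> reduced (letter_mul l w).
Proof.
case: l w => [g|h] [|[a|a] w] rw /=; case: ifP => // n1.
- by rewrite reduced_cons /= n1.
- by move: rw; rewrite reduced_cons => /and3P[].
- by move: rw; rewrite !reduced_cons /= n1 => /and3P[_ -> ->].
- by rewrite reduced_cons /= n1 rw.
- by rewrite reduced_cons /= n1.
- by rewrite reduced_cons /= n1 rw.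
- by move: rw; rewrite reduced_cons => /and3P[].
- by move: rw; rewrite !reduced_cons /= n1 => /and3P[_ -> ->].
Qed.

Definition fp_one : free_product := @FreeProduct [::] isT.

Lemma reduced_mul (u v : free_product) : reduced (foldr letter_mul v u).
Proof.
case: v => v /= rv; elim: (word u) => //= l w; exact: reduced_letter_mul.
Qed.

Definition fp_mul (u v : free_product) : free_product :=
  FreeProduct (reduced_mul u v).

Lemma reduced_inv (u : free_product) : reduced (rev (map letter_inv u)).
Proof.
case: u => u /= /andP[nu su]; apply/andP; split.
  rewrite all_rev all_map; by apply: sub_all nu => -[x|x] /=; rewrite invg_eq1.
rewrite rev_sorted sorted_map.
by case: u su {nu} => //= a u; apply: sub_path => -[?|?] [?|?].
Qed.

Definition fp_inv (u : free_product) : free_product :=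
  FreeProduct (reduced_inv u).

Lemma letter_mulA_inl g g' w : reduced w ->
  letter_mul (inl g) (letter_mul (inl g') w) = letter_mul (inl (g * g')) w.
Proof.
have nil_case g1 g2 v : (if v is inl _ :: _ then false else true) ->
  letter_mul (inl g1) (letter_mul (inl g2) v) = letter_mul (inl (g1 * g2)) v.
  have lmE x u : (if u is inl _ :: _ then false else true) ->
    letter_mul (inl x) u = if x == 1 then u else inl x :: u.
    by case: u => [|[]] //= *; case: eqP.
  move=> nv; rewrite !(lmE _ v nv); have [->|n2] := eqVneq g2 1.
    by rewrite mulg1 lmE.
  by rewrite /=; case: eqP.
case: w => [|[a|h] w] rw; try exact: nil_case.
have nw : is_true (if w is inl _ :: _ then false else true).
  by move: rw; rewrite reduced_cons => /and3P[_]; case: (w) => [|[]].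
have wE x u : (if u is inl _ :: _ then false else true) ->
    letter_mul (inl x) (inl a :: u) = letter_mul (inl (x * a)) u.
  by case: u => [|[]] //= *; case: eqP.
rewrite !(wE _ _ nw).
by rewrite (nil_case _ _ _ nw) mulgA.
Qed.

Lemma letter_mulA_inr h h' w : reduced w ->
  letter_mul (inr h) (letter_mul (inr h') w) = letter_mul (inr (h * h')) w.
Proof.
have nil_case g1 g2 v : (if v is inr _ :: _ then false else true) ->
  letter_mul (inr g1) (letter_mul (inr g2) v) = letter_mul (inr (g1 * g2)) v.
  have lmE x u : (if u is inr _ :: _ then false else true) ->
    letter_mul (inr x) u = if x == 1 then u else inr x :: u.
    by case: u => [|[]] //= *; case: eqP.
  move=> nv; rewrite !(lmE _ v nv); have [->|n2] := eqVneq g2 1.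
    by rewrite mulg1 lmE.
  by rewrite /=; case: eqP.
case: w => [|[g|a] w] rw; try exact: nil_case.
have nw : is_true (if w is inr _ :: _ then false else true).
  by move: rw; rewrite reduced_cons => /and3P[_]; case: (w) => [|[]].
have wE x u : (if u is inr _ :: _ then false else true) ->
    letter_mul (inr x) (inr a :: u) = letter_mul (inr (x * a)) u.
  by case: u => [|[]] //= *; case: eqP.
rewrite !(wE _ _ nw).
by rewrite (nil_case _ _ _ nw) mulgA.
Qed.

Lemma letter_mul1 l w :
  ~~ nontrivial_letter l -> reduced w -> letter_mul l w = w.
Proof.
case: l w => [g|h] [|[a|a] w] /=; rewrite negbK => /eqP ->;
  rewrite ?eqxx ?mul1g // reduced_cons => /and3P[/= /negPf -> //].
Qed.

Lemma letter_mul_cons l w : reduced (l :: w) -> letter_mul l w = l :: w.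
Proof.
by case: l w => [g|h] [|[a|a] w]; rewrite reduced_cons => /and3P[/= nl] //=;
  rewrite nl.
Qed.

Lemma foldr_letter_mul l u w : reduced u -> reduced w ->
  foldr letter_mul w (letter_mul l u) = letter_mul l (foldr letter_mul w u).
Proof.
move=> ru rw; have rf v : reduced (foldr letter_mul w v).
  by elim: v => //= a v; apply: reduced_letter_mul.
have [nl|tl] := boolP (nontrivial_letter l); last first.
  by rewrite !letter_mul1.
case: l u nl ru => [g|h] [|[a|a] u] /= nl ru; rewrite ?nl //.
- rewrite letter_mulA_inl //; case: ifP => //= /eqP ->.
  by rewrite letter_mul1 //= eqxx.
- rewrite letter_mulA_inr //; case: ifP => //= /eqP ->.
  by rewrite letter_mul1 //= eqxx.
Qed.

Lemma fp_mulA : associative fp_mul.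
Proof.
move=> [u ru] [v rv] [w rw]; apply/val_inj => /=.
elim: u {ru} => //= l u ->.
rewrite foldr_letter_mul //; elim: u => //= a u.
exact: reduced_letter_mul.
Qed.

Lemma fp_mul1 : left_id fp_one fp_mul.
Proof. by move=> u; apply/val_inj. Qed.

Lemma fp_mulr1 : right_id fp_one fp_mul.
Proof.
move=> [u ru]; apply/val_inj => /=; elim: u ru => //= l u IHu rlu.
rewrite IHu ?letter_mul_cons //.
by move: rlu; rewrite reduced_cons => /and3P[].
Qed.

Lemma fp_mulV : left_inverse fp_one fp_inv fp_mul.
Proof.
move=> [u ru]; apply/val_inj => /=; elim: u ru => //= l u IHu rlu.
rewrite rev_cons foldr_rcons.
have -> : letter_mul (letter_inv l) (l :: u) = u.
  by case: l {rlu} => x /=; rewrite mulVg eqxx.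
by apply: IHu; move: rlu; rewrite reduced_cons => /and3P[].
Qed.

Lemma fp_invK : involutive fp_inv.
Proof.
move=> [u ru]; apply/val_inj => /=; rewrite map_rev revK -map_comp map_id_in //.
by move=> [x|x] _ /=; rewrite invgK.
Qed.

Lemma fp_mulVr : right_inverse fp_one fp_inv fp_mul.
Proof. by move=> u; rewrite -[X in fp_mul X]fp_invK fp_mulV. Qed.

HB.instance Definition _ := isGroup.Build free_product
  fp_mulA fp_mul1 fp_mulr1 fp_mulV fp_mulVr.

Lemma reduced_of_letter l :
  reduced (if nontrivial_letter l then [:: l] else [::]).
Proof. by case: ifP => // nl; rewrite reduced_cons nl. Qed.

(* Identity elements of both factors are sent to the empty word. *)
Definition of_letter (l : letter) : free_product :=
  FreeProduct (reduced_of_letter l).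

Definition fp_inl (g : G) : free_product := of_letter (inl g).
Definition fp_inr (h : H) : free_product := of_letter (inr h).

Lemma of_letter_mul l (w : free_product) :
  word (of_letter l * w) = letter_mul l w.
Proof.
case: w => w rw /=; rewrite /(_ * _) /=.
by case: ifPn => //= nl; rewrite letter_mul1.
Qed.

Lemma of_letter_mul_reduced l (w : free_product) :
  reduced (l :: w) -> word (of_letter l * w) = l :: w.
Proof. by move=> rlw; rewrite of_letter_mul letter_mul_cons. Qed.

Lemma fp_inlM : {morph fp_inl : x y / x * y}.
Proof.
move=> x y; apply/val_inj; rewrite -[RHS]/(word _) of_letter_mul /=.
have [->|] := eqVneq y 1; first by rewrite mulg1.
by rewrite /= if_neg.
Qed.

Lemma fp_inrM : {morph fp_inr : x y / x * y}.
Proof.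
move=> x y; apply/val_inj; rewrite -[RHS]/(word _) of_letter_mul /=.
have [->|] := eqVneq y 1; first by rewrite mulg1.
by rewrite /= if_neg.
Qed.

Lemma prod_of_letter (w : free_product) : \prod_(l <- w) of_letter l = w.
Proof.
case: w => w rw; apply/val_inj.
rewrite -[LHS]/(word _) /=; elim: w rw => [|l w IHw] rlw.
  by rewrite big_nil.
have rw : reduced w by move: rlw; rewrite reduced_cons => /and3P[].
by rewrite big_cons of_letter_mul IHw //= letter_mul_cons.
Qed.

End FreeProduct.

Section FreeProductOrder.
Variables G H : groupType.

Definition extends_circular_orders (cG : G -> G -> G -> int)
    (cH : H -> H -> H -> int)
    (c : free_product G H -> free_product G H -> free_product G H -> int) :=
  let i := @fp_inl G H in let j := @fp_inr G H in
  [/\ forall g1 g2 g3, c (i g1) (i g2) (i g3) = cG g1 g2 g3,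
      forall h1 h2 h3, c (j h1) (j h2) (j h3) = cH h1 h2 h3,
      forall (g : G) (h : H), g != 1 -> h != 1 -> c 1 (i g) (j h) = 1%R,
      forall (g1 g2 : G) (h : H), g1 != 1 -> g2 != 1 -> h != 1 ->
        c (i g1) (i g2) (j h) = cG g1 g2 1
    & forall (g : G) (h1 h2 : H), g != 1 -> h1 != 1 -> h2 != 1 ->
        c (i g) (j h1) (j h2) = cH 1 h1 h2].

Definition lexicographic
    (c : free_product G H -> free_product G H -> free_product G H -> int) :=
  forall (x : letter G H) (w1 w2 w3 : free_product G H),
    reduced (x :: w1) -> ohead w2 != Some x -> ohead w3 != Some x ->
    c (of_letter x * w1) w2 w3 = c (of_letter x) w2 w3.

End FreeProductOrder.

(* Main.v *)
Require Import Defs.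
From mathcomp Require Import all_boot all_order all_algebra.
From mathcomp Require Import zify.
From Stdlib Require Import FunctionalExtensionality.

(** A circular order on the words is obtained by closing up a linear order:
    compare words lexicographically, where at the first difference letters of
    [H] come before the end of the word, which comes before the letters of [G],
    and each factor is ordered linearly by cutting its circular order at the
    identity.  If [s x y] is the sign of a linear order, the associated
    circular order is the coboundary [s x y + s y z + s z x].  Splitting off a
    possibly trivial first letter of [G], [x = a x'], gives
    [s x y = l a b + (if a == b then s x' y' else 0)], where the coboundary of
    [l] is [cG]; hence left multiplication by [G], and likewise by [H],
    preserves the coboundary of [s].  For uniqueness, the cocycle condition
    reduces everything to [c 1 u v], which is computed by induction on [u]. *)

Set Implicit Arguments.
Unset Strict Implicit.
Unset Printing Implicit Defensive.

Import GRing.Theory.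
Local Open Scope ring_scope.

(** * Linear orders and their cyclic coboundaries *)

Definition coboundary (T : Type) (s : T -> T -> int) x y z :=
  s x y + s y z + s z x.

Lemma coboundary_rot (T : Type) (s : T -> T -> int) x y z :
  coboundary s x y z = coboundary s y z x.
Proof. by rewrite /coboundary; lia. Qed.

(** Here [s x y = 1] means that [x] precedes [y]. The last clause is transitivity: a cyclic triple
    would have coboundary 3 or -3. *)
Definition linear_sign (T : Type) (s : T -> T -> int) : Prop :=
  [/\ forall x y, s x y = - s y x,
      forall x y, s x y = 0 <-> x = y,
      forall x y, -1 <= s x y <= 1
    & forall x y z, -1 <= coboundary s x y z <= 1].

Lemma linear_sign_refl (T : Type) (s : T -> T -> int) x :
  linear_sign s -> s x x = 0.
Proof. by case=> _ s0 _ _; apply/s0. Qed.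

(** Three values 1 or -1 have an odd sum, so a zero coboundary forces one of them to vanish. *)
Lemma coboundary_eq0 (T : Type) (s : T -> T -> int) x y z : linear_sign s ->
  coboundary s x y z = 0 <-> [\/ x = y, y = z | x = z].
Proof.
move=> sl; have [sN s0 sb _] := sl; rewrite /coboundary; split; last first.
  by case=> ->; rewrite ?(linear_sign_refl _ sl) 1?[s z _]sN; lia.
move=> sum0; have [/s0|xy] := eqVneq (s x y) 0; first by constructor 1.
have [/s0|yz] := eqVneq (s y z) 0; first by constructor 2.
have [/s0|zx] := eqVneq (s z x) 0; first by constructor 3.
by move: (sb x y) (sb y z) (sb z x); lia.
Qed.

(** * Cutting a circular order at the identity *)

Section Cut.
Variables (G : groupType) (c : G -> G -> G -> int).
Hypothesis hc : left_invariant_circular_order c.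

Lemma circular_order_swap x y z : c x z y = - c x y z.
Proof.
have [_ c0 cC _] := hc; have := cC x y z y.
have -> : c y z y = 0 by apply/c0; constructor 3.
have -> : c x y y = 0 by apply/c0; constructor 2.
by lia.
Qed.

(** Taken with [x = 1], this recovers the whole order from its triples based at the identity. *)
Lemma circular_order_cocycle x y z t :
  c y z t = c x z t - c x y t + c x y z.
Proof. by have [_ _ cC _] := hc; have := cC x y z t; lia. Qed.

Lemma circular_order_rot x y z : c y z x = c x y z.
Proof.
have [_ c0 _ _] := hc; rewrite (circular_order_cocycle x).
have -> : c x z x = 0 by apply/c0; constructor 3.
have -> : c x y x = 0 by apply/c0; constructor 3.
by lia.
Qed.

Lemma circular_order_1l x : c 1%g 1%g x = 0.
Proof. by have [_ c0 _ _] := hc; apply/c0; constructor 1. Qed.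

Lemma circular_order_1r x : c 1%g x 1%g = 0.
Proof. by have [_ c0 _ _] := hc; apply/c0; constructor 3. Qed.

(* The linear order obtained by cutting at the identity, which becomes the
   least element if [e = 1] and the greatest one if [e = -1]. *)
Definition cut (e : int) (a b : G) : int :=
  c 1%g a b + e * ((a == 1%g)%:R - (b == 1%g)%:R).

(** The correction term is a difference, so it telescopes around the triple; what remains is the
    cocycle condition. *)
Lemma coboundary_cut e x y z : coboundary (cut e) x y z = c x y z.
Proof.
rewrite /coboundary /cut (circular_order_cocycle 1%g x y z).
by rewrite (circular_order_swap 1%g x z); lia.
Qed.

(** The term [c 1 a b] vanishes as soon as [a] or [b] is the identity, and otherwise the correction
    does; so no value leaves the range from -1 to 1. *)
Lemma linear_sign_cut e : e = 1 \/ e = -1 -> linear_sign (cut e).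
Proof.
move=> e1; have [cr c0 _ _] := hc.
have cb x y z : -1 <= c x y z <= 1 by have := cr x y z; rewrite !inE; lia.
have cutN x y : cut e x y = - cut e y x.
  by rewrite /cut (circular_order_swap 1%g y x); lia.
split=> // [x y|x y|x y z]; last by rewrite coboundary_cut.
- rewrite /cut; have [->|x1] := eqVneq x 1%g.
    rewrite circular_order_1l; have [->|y1] := eqVneq y 1%g.
      by split=> // _; lia.
    by split=> [|y1']; [lia | rewrite -y1' eqxx in y1].
  have [->|y1] := eqVneq y 1%g.
    rewrite circular_order_1r.
    by split=> [|x1']; [lia | rewrite x1' eqxx in x1].
  rewrite subrr mulr0 addr0; split=> [/c0[xE|//|yE]|->].
  - by rewrite xE eqxx in x1.
  - by rewrite yE eqxx in y1.
  - by apply/c0; constructor 2.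
- rewrite /cut; have [->|x1] := eqVneq x 1%g.
    by rewrite circular_order_1l; lia.
  have [->|y1] := eqVneq y 1%g; first by rewrite circular_order_1r; lia.
  by have := cb 1%g x y; lia.
Qed.

End Cut.

(** * Lexicographic comparison of words *)

Section Lexicographic.
Variables (T : eqType) (s : option T -> option T -> int).
Hypothesis sl : linear_sign s.

(** [None] marks the end of a word, so [s] also places a word relative to its extensions. *)
Fixpoint lex_sign (u v : seq T) : int :=
  match u, v with
  | a :: u', b :: v' =>
      if a == b then lex_sign u' v' else s (Some a) (Some b)
  | _, _ => s (ohead u) (ohead v)
  end.

Lemma lex_sign_ohead u v :
  ohead u != ohead v -> lex_sign u v = s (ohead u) (ohead v).
Proof.
case: u v => [|a u] [|b v] //= /eqP ab.
by case: eqP => // abE; case: ab; rewrite abE.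
Qed.

Lemma lex_signN u v : lex_sign u v = - lex_sign v u.
Proof.
have [sN _ _ _] := sl.
by elim: u v => [|a u IHu] [|b v] //=; rewrite eq_sym; case: eqP.
Qed.

Lemma lex_sign_eq0 u v : lex_sign u v = 0 <-> u = v.
Proof.
have [_ s0 _ _] := sl.
elim: u v => [|a u IHu] [|b v] /=; try by rewrite s0.
case: eqP => [<-|ab]; first by rewrite IHu; split=> [->|[]].
by rewrite s0; split=> -[].
Qed.

Lemma lex_sign_bound u v : -1 <= lex_sign u v <= 1.
Proof.
have [_ _ sb _] := sl.
by elim: u v => [|a u IHu] [|b v] //=; case: eqP.
Qed.

(** Both comparisons with [w] are decided at the first letter, where [u] and [v] agree, so they
    cancel. *)
Lemma coboundary_lex_sign_eq_ohead u v w :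
  ohead u = ohead v -> ohead v != ohead w ->
  coboundary lex_sign u v w = lex_sign u v.
Proof.
have [sN _ _ _] := sl; rewrite /coboundary => uv vw.
rewrite (lex_sign_ohead vw) (@lex_sign_ohead w u) uv 1?eq_sym //.
by rewrite [s (ohead w) _]sN; lia.
Qed.

Lemma linear_sign_lex : linear_sign lex_sign.
Proof.
have [_ _ _ st] := sl.
split; [exact: lex_signN | exact: lex_sign_eq0 | exact: lex_sign_bound |].
have bound_pair u v w : ohead u = ohead v -> ohead v != ohead w ->
    -1 <= coboundary lex_sign u v w <= 1.
  move=> uv vw; rewrite coboundary_lex_sign_eq_ohead //.
  exact: lex_sign_bound.
(* Exactly two equal heads fall under [bound_pair], three distinct ones under the bound for [s];
   only triples with a common head are left to the induction. *)
have bound_step u v w :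
    (ohead u = ohead v -> ohead v = ohead w ->
      -1 <= coboundary lex_sign u v w <= 1) ->
    -1 <= coboundary lex_sign u v w <= 1.
  have [uv|uv] := eqVneq (ohead u) (ohead v); last move=> _.
    have [vw|vw _] := eqVneq (ohead v) (ohead w); first exact.
    exact: bound_pair.
  have [vw|vw] := eqVneq (ohead v) (ohead w).
    by rewrite coboundary_rot bound_pair // -vw eq_sym.
  have [wu|wu] := eqVneq (ohead w) (ohead u).
    by rewrite -coboundary_rot bound_pair // eq_sym.
  by rewrite /coboundary !lex_sign_ohead //; apply: st.
elim=> [|a u IHu] v w; apply: bound_step.
  by case: v w => [|? ?] [|? ?] // _ _; apply: (st None None None).
case: v w => [|b v] [|d w] //= [<-] [<-].
by rewrite /coboundary /= eqxx; apply: IHu.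
Qed.

End Lexicographic.

(** * Existence: the circular order on the free product *)

Section FreeProductCircularOrder.
Variables (G H : groupType) (cG : G -> G -> G -> int) (cH : H -> H -> H -> int).
Hypotheses (hG : left_invariant_circular_order cG)
           (hH : left_invariant_circular_order cH).

Notation letter := (letter G H).

(** The identity of either factor is the empty word, so it must sit where [None] does: least in [G],
    whence [cut cG 1], and greatest in [H], whence [cut cH (-1)]. *)
Definition letter_sign (x y : option letter) : int :=
  match x, y with
  | Some (inl a), Some (inl b) => cut cG 1 a b
  | Some (inr a), Some (inr b) => cut cH (-1) a b
  | Some (inl _), _ => -1
  | Some (inr _), _ => 1
  | None, Some (inl _) => 1
  | None, Some (inr _) => -1
  | None, None => 0
  end.

Lemma linear_sign_letter : linear_sign letter_sign.
Proof.
have [? G0 Gb Gt] := linear_sign_cut hG (or_introl (erefl 1)).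
have [? H0 Hb Ht] := linear_sign_cut hH (or_intror (erefl (-1))).
split.
- by move=> [[x|x]|] [[y|y]|] //=.
- move=> [[x|x]|] [[y|y]|] //=; first by rewrite G0; split=> [->|[]].
  by rewrite H0; split=> [->|[]].
- by move=> [[x|x]|] [[y|y]|] /=; by [apply: Gb|apply: Hb|].
move=> [[x|x]|] [[y|y]|] [[z|z]|]; rewrite /coboundary //=.
all: try by [apply: Gt|apply: Ht].
(* With two letters in one factor and the third entry outside it, the comparisons with the third
   cancel and one [cut] is left. *)
all: by [ have := Gb x y; move: (cut _ _ _ _); lia
        | have := Gb y z; move: (cut _ _ _ _); lia
        | have := Gb z x; move: (cut _ _ _ _); lia
        | have := Hb x y; move: (cut _ _ _ _); lia
        | have := Hb y z; move: (cut _ _ _ _); lia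
        | have := Hb z x; move: (cut _ _ _ _); lia ].
Qed.

Definition word_sign : seq letter -> seq letter -> int := lex_sign letter_sign.

Lemma linear_sign_word : linear_sign word_sign.
Proof. exact/linear_sign_lex/linear_sign_letter. Qed.

(* Each reduced word is written as an element of [G], possibly [1], followed by
   a word which does not start with a letter of [G]; likewise for [H]. *)
Definition headG (w : seq letter) : G := if w is inl g :: _ then g else 1%g.
Definition tailG (w : seq letter) := if w is inl _ :: w' then w' else w.
Definition headH (w : seq letter) : H := if w is inr h :: _ then h else 1%g.
Definition tailH (w : seq letter) := if w is inr _ :: w' then w' else w.

Lemma letter_mul_inl g w : reduced w ->
  headG (letter_mul (inl g) w) = (g * headG w)%g
  /\ tailG (letter_mul (inl g) w) = tailG w.
Proof.
case: w => [|[a|a] w] /=.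
- by rewrite mulg1; case: eqP => [->|].
(* If [g] cancels the letter [a], the rest of the word is empty or starts in [H], so it has head 1
   and is its own tail. *)
- rewrite reduced_cons => /and3P[_ aw _].
  by case: eqP => [->|] //=; case: w aw => [|[]].
- by rewrite mulg1; case: eqP => [->|].
Qed.

Lemma letter_mul_inr h w : reduced w ->
  headH (letter_mul (inr h) w) = (h * headH w)%g
  /\ tailH (letter_mul (inr h) w) = tailH w.
Proof.
case: w => [|[a|a] w] /=.
- by rewrite mulg1; case: eqP => [->|].
- by rewrite mulg1; case: eqP => [->|].
- rewrite reduced_cons => /and3P[_ aw _].
  by case: eqP => [->|] //=; case: w aw => [|[]].
Qed.

(** A word not starting in [G] has head 1, which [cut cG 1] puts below all other heads, just as
    [letter_sign] puts [None] and the letters of [H] below those of [G]. *)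
Lemma word_signG u v : reduced u -> reduced v ->
  word_sign u v = cut cG 1 (headG u) (headG v) +
    (if headG u == headG v then word_sign (tailG u) (tailG v) else 0).
Proof.
have sl := linear_sign_cut hG (or_introl (erefl 1)).
have cut1x x : x != 1%g -> cut cG 1 1%g x = 1.
  by rewrite /cut eqxx (circular_order_1l hG) => /negbTE ->.
have cutx1 x : x != 1%g -> cut cG 1 x 1%g = -1.
  by rewrite /cut eqxx (circular_order_1r hG) => /negbTE ->.
case: u v => [|[a|a] u] [|[b|b] v]; rewrite ?reduced_cons /word_sign /=.
all: try by move=> *; rewrite eqxx (linear_sign_refl _ sl) add0r.
- by move=> _ /andP[b1 _]; rewrite cut1x // eq_sym (negbTE b1).
- by move=> /andP[a1 _] _; rewrite cutx1 // (negbTE a1).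
- move=> _ _; rewrite -[inl a == inl b]/(a == b); case: eqP => [->|_].
    by rewrite (linear_sign_refl _ sl) add0r.
  by rewrite addr0.
- by move=> /andP[a1 _] _; rewrite cutx1 // (negbTE a1).
- by move=> _ /andP[b1 _]; rewrite cut1x // eq_sym (negbTE b1).
Qed.

Lemma word_signH u v : reduced u -> reduced v ->
  word_sign u v = cut cH (-1) (headH u) (headH v) +
    (if headH u == headH v then word_sign (tailH u) (tailH v) else 0).
Proof.
have sl := linear_sign_cut hH (or_intror (erefl (-1))).
have cut1x x : x != 1%g -> cut cH (-1) 1%g x = -1.
  by rewrite /cut eqxx (circular_order_1l hH) => /negbTE ->.
have cutx1 x : x != 1%g -> cut cH (-1) x 1%g = 1.
  by rewrite /cut eqxx (circular_order_1r hH) => /negbTE ->.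
case: u v => [|[a|a] u] [|[b|b] v]; rewrite ?reduced_cons /word_sign /=.
all: try by move=> *; rewrite eqxx (linear_sign_refl _ sl) add0r.
- by move=> _ /andP[b1 _]; rewrite cut1x // eq_sym (negbTE b1).
- by move=> _ /andP[b1 _]; rewrite cut1x // eq_sym (negbTE b1).
- by move=> /andP[a1 _] _; rewrite cutx1 // (negbTE a1).
- by move=> /andP[a1 _] _; rewrite cutx1 // (negbTE a1).
- move=> _ _; rewrite -[inr a == inr b]/(a == b); case: eqP => [->|_].
    by rewrite (linear_sign_refl _ sl) add0r.
  by rewrite addr0.
Qed.

(** Around the triple, the [cut] terms add up to the invariant order of the factor; the others
    depend only on the tails and on which heads agree, and left multiplication changes neither. *)
Lemma coboundary_word_sign_letter_mul l u v w :
  reduced u -> reduced v -> reduced w ->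
  coboundary word_sign (letter_mul l u) (letter_mul l v) (letter_mul l w) =
  coboundary word_sign u v w.
Proof.
move=> ru rv rw; have rl x := @reduced_letter_mul G H l x.
have split3 (p q r p' q' r' : int) :
  (p + p') + (q + q') + (r + r') = (p + q + r) + (p' + q' + r') by lia.
case: l rl => [g|h] rl; rewrite /coboundary.
- have [_ _ _ cGl] := hG; rewrite (word_signG (rl _ ru) (rl _ rv)).
  rewrite (word_signG (rl _ rv) (rl _ rw)) (word_signG (rl _ rw) (rl _ ru)).
  rewrite (word_signG ru rv) (word_signG rv rw) (word_signG rw ru)
    split3 [RHS]split3.
  have [-> ->] := letter_mul_inl g ru; have [-> ->] := letter_mul_inl g rv.
  have [-> ->] := letter_mul_inl g rw; rewrite !(inj_eq (mulgI g)).
  by rewrite -!/(coboundary (cut _ _) _ _ _) !coboundary_cut ?cGl.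
- have [_ _ _ cHl] := hH; rewrite (word_signH (rl _ ru) (rl _ rv)).
  rewrite (word_signH (rl _ rv) (rl _ rw)) (word_signH (rl _ rw) (rl _ ru)).
  rewrite (word_signH ru rv) (word_signH rv rw) (word_signH rw ru)
    split3 [RHS]split3.
  have [-> ->] := letter_mul_inr h ru; have [-> ->] := letter_mul_inr h rv.
  have [-> ->] := letter_mul_inr h rw; rewrite !(inj_eq (mulgI h)).
  by rewrite -!/(coboundary (cut _ _) _ _ _) !coboundary_cut ?cHl.
Qed.

Definition fp_circular_order (x y z : free_product G H) : int :=
  coboundary word_sign (word x) (word y) (word z).

Lemma fp_circular_order_left_invariant :
  left_invariant_circular_order fp_circular_order.
Proof.
have sl := linear_sign_word; have [sN _ _ sb] := sl.
split=> [x y z|x y z|x y z t|g x y z].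
- rewrite !inE /fp_circular_order.
  by move: (sb (word x) (word y) (word z)); lia.
- rewrite /fp_circular_order (coboundary_eq0 _ _ _ sl).
  split=> -[E|E|E];
    do [by constructor 1; exact/val_inj | by constructor 2; exact/val_inj
       | by constructor 3; exact/val_inj
       | by constructor 1; rewrite E | by constructor 2; rewrite E
       | by constructor 3; rewrite E].
- rewrite /fp_circular_order /coboundary.
  rewrite (sN (word z) (word x)) (sN (word t) (word x)).
  by rewrite (sN (word t) (word y)); lia.
- rewrite /fp_circular_order.
  (* Multiplying by a word is multiplying by its letters one at a time. *)
  have wM u v : word (u * v)%g = foldr (@letter_mul G H) v (word u) by [].
  rewrite !wM; elim: (word g) => //= l w IHw.
  rewrite coboundary_word_sign_letter_mul //.
  all: by elim: (w) => [|a w' ?] /=; [apply: valP | apply: reduced_letter_mul].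
Qed.

Lemma word_sign_inl a b : word_sign (fp_inl H a) (fp_inl H b) = cut cG 1 a b.
Proof.
have hE x : headG (fp_inl H x) = x by rewrite /=; case: eqP => [->|].
have tE x : tailG (fp_inl H x) = [::] by rewrite /=; case: eqP.
rewrite word_signG ?reduced_of_letter // !hE !tE /word_sign /= if_same.
exact: addr0.
Qed.

Lemma word_sign_inr a b : word_sign (fp_inr G a) (fp_inr G b) = cut cH (-1) a b.
Proof.
have hE x : headH (fp_inr G x) = x by rewrite /=; case: eqP => [->|].
have tE x : tailH (fp_inr G x) = [::] by rewrite /=; case: eqP.
rewrite word_signH ?reduced_of_letter // !hE !tE /word_sign /= if_same.
exact: addr0.
Qed.

Lemma fp_circular_order_extends :
  extends_circular_orders cG cH fp_circular_order.
Proof.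
split=> [a b d|a b d|a b a1 b1|a b d a1 b1 d1|a b d a1 b1 d1];
  rewrite /fp_circular_order.
- by rewrite -(coboundary_cut hG 1) /coboundary !word_sign_inl.
- by rewrite -(coboundary_cut hH (-1)) /coboundary !word_sign_inr.
- by rewrite /= a1 b1.
- rewrite /coboundary word_sign_inl /= a1 b1 d1 /word_sign /=.
  rewrite /cut (negbTE a1) (negbTE b1) (circular_order_rot hG 1%g).
  by lia.
- rewrite /coboundary word_sign_inr /= a1 b1 d1 /word_sign /=.
  by rewrite /cut (negbTE b1) (negbTE d1); lia.
Qed.

(** As neither [w2] nor [w3] starts with [x], each comparison with [x :: w1] is decided at its first
    letter. *)
Lemma fp_circular_order_lexicographic : lexicographic fp_circular_order.
Proof.
move=> x w1 w2 w3 rx x2 x3.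
have nx : nontrivial_letter x by move: rx; rewrite reduced_cons => /and3P[].
have sl v w : ohead w != Some x ->
    word_sign (x :: v) w = letter_sign (Some x) (ohead w).
  by move=> wx; apply: (@lex_sign_ohead _ _ (x :: v)); rewrite eq_sym.
have sr v w : ohead w != Some x ->
    word_sign w (x :: v) = letter_sign (ohead w) (Some x).
  by move=> wx; apply: (@lex_sign_ohead _ _ _ (x :: v)).
rewrite /fp_circular_order of_letter_mul_reduced //.
have -> : word (of_letter x) = [:: x] by rewrite /= nx.
by rewrite /coboundary !sl ?sr.
Qed.

End FreeProductCircularOrder.

(** * Uniqueness *)

Section Uniqueness.
Variables (G H : groupType) (cG : G -> G -> G -> int) (cH : H -> H -> H -> int).
Variables c d : free_product G H -> free_product G H -> free_product G H -> int.
Hypotheses (hc : left_invariant_circular_order c)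
           (ec : extends_circular_orders cG cH c) (lc : lexicographic c).
Hypotheses (hd : left_invariant_circular_order d)
           (ed : extends_circular_orders cG cH d) (ld : lexicographic d).

Lemma fp_cons (u : free_product G H) x w : word u = x :: w ->
  exists2 w' : free_product G H,
    w = word w' /\ reduced (x :: word w') & u = (of_letter x * w')%g.
Proof.
case: u => u ru /= uE; rewrite {u}uE in ru *.
have rw : reduced w by move: ru; rewrite reduced_cons => /and3P[].
exists (FreeProduct rw) => //.
by apply/val_inj; rewrite -[RHS]/(word _) of_letter_mul_reduced.
Qed.

(** Rotation brings each word in turn to the front, where the lexicographic condition strips it to
    its first letter. *)
Lemma lexicographic_based c' x y (u v : free_product G H) :
  left_invariant_circular_order c' -> lexicographic c' ->
  reduced (x :: u) -> reduced (y :: v) -> x != y ->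
  c' 1%g (of_letter x * u)%g (of_letter y * v)%g =
  c' 1%g (of_letter x) (of_letter y).
Proof.
move=> hc' lc' ru rv xy.
have nx : nontrivial_letter x by move: ru; rewrite reduced_cons => /andP[].
rewrite -(circular_order_rot hc') lc' ?of_letter_mul_reduced //; last first.
  by rewrite eq_sym.
rewrite -(circular_order_rot hc') lc' //= ?nx //.
by rewrite -(circular_order_rot hc').
Qed.

(** For letters of one factor the whole triple lies in the image of that factor; mixed letters come
    down, up to a swap, to the prescribed value of [c 1 g h]. *)
Lemma eq_of_letter x y : nontrivial_letter x -> nontrivial_letter y ->
  c 1%g (of_letter x) (of_letter y) = d 1%g (of_letter x) (of_letter y).
Proof.
have [cGG cHH cGH _ _] := ec; have [dGG dHH dGH _ _] := ed.
have i1 : fp_inl H (1%g : G) = 1%g by apply/val_inj => /=; rewrite eqxx.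
have j1 : fp_inr G (1%g : H) = 1%g by apply/val_inj => /=; rewrite eqxx.
case: x y => [a|a] [b|b] /= a1 b1; rewrite -/(fp_inl _ _) -/(fp_inr _ _).
- by rewrite -{1 2}i1 cGG dGG.
- by rewrite cGH ?dGH.
- by rewrite (circular_order_swap hc) (circular_order_swap hd) cGH ?dGH.
- by rewrite -{1 2}j1 cHH dHH.
Qed.

Lemma eq_ohead_neq u v :
  ohead (word u) != ohead (word v) -> c 1%g u v = d 1%g u v.
Proof.
case uE: (word u) => [|x u1]; case vE: (word v) => [|y v1] //= uv.
- have -> : u = 1%g by apply/val_inj.
  by rewrite (circular_order_1l hc) (circular_order_1l hd).
- have -> : v = 1%g by apply/val_inj.
  by rewrite (circular_order_1r hc) (circular_order_1r hd).
have [u' [_ ru] ->] := fp_cons uE; have [v' [_ rv] ->] := fp_cons vE.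
rewrite !lexicographic_based //; apply: eq_of_letter.
  by move: ru; rewrite reduced_cons => /andP[].
by move: rv; rewrite reduced_cons => /andP[].
Qed.

Lemma of_letterV (x : letter G H) :
  (of_letter x)^-1%g = of_letter (letter_inv x).
Proof.
by apply/val_inj; case: x => x /=; rewrite invg_eq1; case: eqP.
Qed.

(* Cancelling a common first letter [x] moves the base point from [1] to
   [x^-1], which is brought back by the cocycle condition. *)
Lemma eq_based u v : c 1%g u v = d 1%g u v.
Proof.
have [n] := ubnP (size (word u)); elim: n u v => // n IHn u v.
have [|/eq_ohead_neq //] := eqVneq (ohead (word u)) (ohead (word v)).
case uE: (word u) => [|x u1] /= uv un.
  have -> : u = 1%g by apply/val_inj.
  by rewrite (circular_order_1l hc) (circular_order_1l hd).
case vE: (word v) uv => [|y v1] //= [yx]; rewrite -yx in vE.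
have [u' [u'E ru] ->] := fp_cons uE; have [v' [_ rv] ->] := fp_cons vE.
have base c' : left_invariant_circular_order c' ->
    c' 1%g (of_letter x * u')%g (of_letter x * v')%g =
    c' 1%g u' v' - c' 1%g (of_letter (letter_inv x)) v'
      + c' 1%g (of_letter (letter_inv x)) u'.
  move=> hc'; rewrite -(circular_order_cocycle hc').
  have [_ _ _ c'M] := hc'.
  by rewrite -(c'M (of_letter (letter_inv x))) -of_letterV mulg1 !mulKg.
(* The inverse of [x] lies in the factor of [x], while a word that can follow [x] is empty or starts
   in the other factor. *)
have neqV (w : free_product G H) : reduced (x :: w) ->
    ohead (word (of_letter (letter_inv x))) != ohead w.
  rewrite reduced_cons; case: (x) => a /= /and3P[a1 aw _].
    by rewrite invg_eq1 a1; case: (word w) aw => [|[]].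
  by rewrite invg_eq1 a1; case: (word w) aw => [|[]].
rewrite !base // IHn -?u'E //.
by rewrite !(eq_ohead_neq (neqV _ _)).
Qed.

Lemma eq_circular_order : c = d.
Proof.
do 3![apply: functional_extensionality => ?].
rewrite (circular_order_cocycle hc 1%g) (circular_order_cocycle hd 1%g).
by rewrite !eq_based.
Qed.

End Uniqueness.

Theorem theorem4p3 (G H : groupType)
    (cG : G -> G -> G -> int) (cH : H -> H -> H -> int)
    (hG : left_invariant_circular_order cG)
    (hH : left_invariant_circular_order cH) :
  exists! c : free_product G H -> free_product G H -> free_product G H -> int,
    [/\ left_invariant_circular_order c,
        extends_circular_orders cG cH c
      & lexicographic c].
Proof.
exists (fp_circular_order cG cH); split.
  split; [exact: fp_circular_order_left_invariant |
          exact: fp_circular_order_extends |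
          exact: fp_circular_order_lexicographic].
move=> c [hc ec lc]; apply: eq_circular_order hc ec lc.
- exact: fp_circular_order_left_invariant.
- exact: fp_circular_order_extends.
- exact: fp_circular_order_lexicographic.
Qed.
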